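(* Let $A$ be a $PMV_f$-algebra. Then $Id_W(A)=Id(A)$, and furthermore $Spec_W(A)\subseteq Spec(A)$.
   Context: An MV-algebra is $(A,\oplus,\neg,0)$ with $(A,\oplus,0)$ a commutative monoid, $\neg\neg x=x$, $x\oplus\neg 0=\neg 0$, $\neg(\neg x\oplus y)\oplus y=\neg(\neg y\oplus x)\oplus x$. Put $x\ominus y=\neg(\neg x\oplus y)$; the lattice order is $x\le y\iff x\ominus y=0$. A $PMV_f$-algebra is an MV-algebra with an associative commutative product $\cdot$ such that for all $a,b,c$: $a0=0$; $a(b\oplus c)\le ab\oplus ac$; $ab\le a\wedge b$; $a(b\ominus c)=ab\ominus ac$. $Id(A)$ is the set of ideals of the underlying MV-algebra: nonempty subsets $I$ that are down-closed and closed under $\oplus$. $Spec(A)$ is the set of $P\in Id(A)$ such that $a\wedge b\in P$ implies $a\in P$ or $b\in P$. $Id_W(A)$ is the set of $I\in Id(A)$ that are absorbent: $a\in I$, $b\in A$ imply $ab\in I$. $Spec_W(A)$ is the set of $P\in Id_W(A)$ such that $ab\in P$ implies $a\in P$ or $b\in P$. *)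

(* Defs.v *)
From HB Require Import structures.
From mathcomp Require Import all_boot.
From mathcomp Require Import classical_sets.

Set Implicit Arguments.
Unset Strict Implicit.
Unset Printing Implicit Defensive.

Local Open Scope classical_set_scope.

Declare Scope mv_scope.
Delimit Scope mv_scope with MV.
Local Open Scope mv_scope.

Reserved Notation "x ⊕ y" (at level 50, left associativity).
Reserved Notation "x ⊖ y" (at level 50, left associativity).
Reserved Notation "x ⋅ y" (at level 40, left associativity).
Reserved Notation "x ⊓ y" (at level 40, left associativity).
Reserved Notation "x ≤ y" (at level 70, no associativity).

HB.mixin Record isMV (T : Type) := {
  mv0 : T;
  mvneg : T -> T;
  mvadd : T -> T -> T;
  mvaddA : associative mvadd;
  mvaddC : commutative mvadd;
  mvadd0x : left_id mv0 mvadd;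
  mvnegK : involutive mvneg;
  mvaddx1 : forall x, mvadd x (mvneg mv0) = mvneg mv0;
  mvadd_neg_swap : forall x y,
    mvadd (mvneg (mvadd (mvneg x) y)) y = mvadd (mvneg (mvadd (mvneg y) x)) x
}.

#[short(type="mvType")]
HB.structure Definition MV := { T of isMV T }.

Notation "x ⊕ y" := (mvadd x y) : mv_scope.

Definition mvsub (A : mvType) (x y : A) : A := mvneg (mvneg x ⊕ y).
Notation "x ⊖ y" := (mvsub x y) : mv_scope.

Definition mvle (A : mvType) (x y : A) : Prop := x ⊖ y = mv0.
Notation "x ≤ y" := (mvle x y) : mv_scope.

(* The usual term for the infimum of the order [mvle]; see [mvmeet_glb]. *)
Definition mvmeet (A : mvType) (x y : A) : A := x ⊖ (x ⊖ y).
Notation "x ⊓ y" := (mvmeet x y) : mv_scope.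

Section MVOrder.
Variable A : mvType.
Implicit Types x y z u v w : A.

Lemma mvaddNx x : mvneg x ⊕ x = mvneg mv0.
Proof.
by have := mvadd_neg_swap x (mvneg mv0); rewrite mvaddx1 mvnegK mvadd0x.
Qed.

Lemma mvleE x y : x ≤ y <-> mvneg x ⊕ y = mvneg mv0.
Proof. by rewrite /mvle /mvsub; split=> [<-|->]; rewrite mvnegK. Qed.

Lemma mvleP x y : x ≤ y <-> exists z, y = x ⊕ z.
Proof.
split=> [le_xy|[z ->]]; last first.
  by apply/mvleE; rewrite mvaddA mvaddNx mvaddC mvaddx1.
exists (y ⊖ x); rewrite mvaddC /mvsub -mvadd_neg_swap -[mvneg (_ ⊕ y)]/(x ⊖ y).
by rewrite le_xy mvadd0x.
Qed.

Lemma mvle_refl x : x ≤ x.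
Proof. by apply/mvleE; rewrite mvaddNx. Qed.

Lemma mvle_anti x y : x ≤ y -> y ≤ x -> x = y.
Proof.
move=> le_xy le_yx; have := mvadd_neg_swap x y.
by rewrite -/(x ⊖ y) -/(y ⊖ x) le_xy le_yx !mvadd0x.
Qed.

Lemma mvle_trans x y z : x ≤ y -> y ≤ z -> x ≤ z.
Proof.
move=> /mvleP[u ->] /mvleP[v ->]; apply/mvleP.
by exists (u ⊕ v); rewrite mvaddA.
Qed.

Lemma mvle_neg x y : x ≤ y -> mvneg y ≤ mvneg x.
Proof. by move=> /mvleE le_xy; apply/mvleE; rewrite mvnegK mvaddC. Qed.

Lemma mvle_addl x y z : x ≤ y -> x ⊕ z ≤ y ⊕ z.
Proof.
move=> /mvleP[u ->]; apply/mvleP; exists u.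
by rewrite -!mvaddA (mvaddC u).
Qed.

Lemma mvmeetC x y : x ⊓ y = y ⊓ x.
Proof.
have := mvadd_neg_swap (mvneg y) (mvneg x); rewrite !mvnegK => swapE.
rewrite /mvmeet /mvsub [mvneg x ⊕ mvneg (_ ⊕ _)]mvaddC.
rewrite [mvneg y ⊕ mvneg (_ ⊕ _)]mvaddC.
by rewrite (mvaddC _ y) (mvaddC _ x) swapE.
Qed.

Lemma mvmeet_lel x y : x ⊓ y ≤ x.
Proof.
apply/mvleE; rewrite /mvmeet {1}/mvsub mvnegK mvaddC mvaddA (mvaddC x).
by rewrite mvaddNx mvaddC mvaddx1.
Qed.

Lemma mvmeet_glb x y z : z ≤ x ⊓ y <-> z ≤ x /\ z ≤ y.
Proof.
split=> [le_zm|[le_zx le_zy]].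
  split; apply: (mvle_trans le_zm); first exact: mvmeet_lel.
  by rewrite mvmeetC; exact: mvmeet_lel.
rewrite -[z]mvnegK /mvmeet {1}/mvsub; apply: mvle_neg.
have le_xz : mvneg y ⊖ mvneg x ≤ mvneg z ⊖ mvneg x.
  by apply/mvle_neg/mvle_addl/mvle_neg/mvle_neg.
have := mvle_addl (mvneg x) le_xz.
have -> : (mvneg z ⊖ mvneg x) ⊕ mvneg x = mvneg z.
  rewrite /mvsub -mvadd_neg_swap -[mvneg (_ ⊕ mvneg z)]/(mvneg x ⊖ mvneg z).
  by rewrite (mvle_neg le_zx) mvadd0x.
by rewrite mvaddC /mvsub mvnegK (mvaddC y).
Qed.

End MVOrder.

HB.mixin Record MV_isPMVf (T : Type) of MV T := {
  pmul : T -> T -> T;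
  pmulA : associative pmul;
  pmulC : commutative pmul;
  pmulx0 : forall a : T, pmul a mv0 = mv0;
  pmulD_le : forall a b c : T, pmul a (b ⊕ c) ≤ pmul a b ⊕ pmul a c;
  pmul_le_meet : forall a b : T, pmul a b ≤ a ⊓ b;
  pmulB : forall a b c : T, pmul a (b ⊖ c) = pmul a b ⊖ pmul a c
}.

#[short(type="pmvfType")]
HB.structure Definition PMVf := { T of MV T & MV_isPMVf T }.

Notation "x ⋅ y" := (pmul x y) : mv_scope.

Definition Id (A : mvType) : set (set A) :=
  [set I | [/\ I !=set0,
               forall a b : A, a ≤ b -> I b -> I a &
               forall a b : A, I a -> I b -> I (a ⊕ b)]].

(* As in the source, prime ideals are not required to be proper, here and in
   [Spec_W]. *)
Definition Spec (A : mvType) : set (set A) :=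
  [set P | Id P /\ forall a b : A, P (a ⊓ b) -> P a \/ P b].

Definition Id_W (A : pmvfType) : set (set A) :=
  [set I | Id I /\ forall a b : A, I a -> I (a ⋅ b)].

Definition Spec_W (A : pmvfType) : set (set A) :=
  [set P | Id_W P /\ forall a b : A, P (a ⋅ b) -> P a \/ P b].

Arguments Id : clear implicits.
Arguments Spec : clear implicits.
Arguments Id_W : clear implicits.
Arguments Spec_W : clear implicits.

(* Main.v *)
Require Import Defs.
From mathcomp Require Import all_boot.
From mathcomp Require Import classical_sets.

Local Open Scope classical_set_scope.

(** Both claims rest on the axiom [pmul_le_meet], which puts the product below
    the infimum.  As [a ⋅ b] lies below [a], down-closure alone makes every ideal
    absorbent.  As [a ⋅ b] lies below [a ⊓ b], an ideal containing [a ⊓ b]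
    contains [a ⋅ b], so primeness for the product implies primeness for the
    infimum. *)

Theorem proposition3p7 (A : pmvfType) :
  Id_W A = Id A /\ Spec_W A `<=` Spec A.
Proof.
split=> [|P [[idP _] primeP]].
  apply/seteqP; split=> [I []//|I idI]; split=> // a b Ia.
  case: idI => _ downI _; apply: downI Ia.
  exact: mvle_trans (pmul_le_meet a b) (mvmeet_lel a b).
split=> // a b Pab; apply: primeP.
by case: idP => _ downP _; apply: downP Pab; exact: pmul_le_meet.
Qed.
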